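(* Let $M$ be a complete connected Riemannian manifold and $Z$ a smooth vector field on $M$. Let $X=X(x)$ be a diffusion with generator $\Delta+Z$ on $M$, starting at $X_0(x)=x$, which is assumed to be non-explosive. Let $T>0$ and let $h$ be an adapted real-valued process with paths in $L^{1,2}([0,T];\mathbb{R})$ such that $h_0=0$ and $h_T=1$. Let $V$ be a bounded smooth vector field on $M$, put $\alpha=V^\flat$, and assume that the process $$(\operatorname{div}\alpha_{T-t})(X_t(x))\,h_t-\frac12\,\alpha_{T-t}\left(/\!/_t\,\Theta_t\int_0^t\left(\dot h_s-(\operatorname{div}Z)(X_s(x))h_s\right)\Theta_s^{-1}\,dB_s\right),\qquad 0\le t\le T,$$ is a true martingale. Then $$\mathbb{E}\bigl[(\operatorname{div}V)(X_T(x))\bigr]=\frac12\,\mathbb{E}\left[\Bigl\langle V(X_T(x)),\,/\!/_T\,\Theta_T\int_0^T\left(\dot h_t-(\operatorname{div}Z)(X_t(x))h_t\right)\Theta_t^{-1}\,dB_t\Bigr\rangle\right],$$ where $\Theta$ is the $\operatorname{Aut}(T_xM)$-valued process defined by the pathwise differential equation $$\frac{d}{dt}\Theta_t=-\,/\!/_t^{-1}\left(\operatorname{Ric}^\sharp+(\nabla_{\bullet}Z)^{*}-\operatorname{div}Z\right)/\!/_t\,\Theta_t,\qquad \Theta_0=\mathrm{id}_{T_xM}.$$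
   Context: $\nabla$ is the Levi-Civita connection, $\operatorname{Ric}^\sharp v=\operatorname{Ric}(v,\cdot)^\sharp$, and $(\nabla_\bullet Z)^*$ is the fibrewise adjoint of the endomorphism $v\mapsto\nabla_vZ$ of $TM$; $\operatorname{div}Z=\operatorname{trace}(v\mapsto\nabla_vZ)$ acts by multiplication, and $\operatorname{div}\alpha=\operatorname{div}\alpha^\sharp$ for a 1-form $\alpha$. The diffusion is constructed as $X_t(x)=\pi(U_t)$, where $\pi:O(M)\to M$ is the orthonormal frame bundle and $U$ solves the Stratonovich equation $dU_t=\sum_{i=1}^nH_i(U_t)\circ dB^i_t+\bar Z(U_t)\,dt$, $\pi(U_0)=x$, with $H_i$ the standard horizontal vector fields, $\bar Z$ the horizontal lift of $Z$, and $(B^i)$ an $\mathbb{R}^n$-valued Brownian motion sped up by $2$, i.e. $dB^i_t\,dB^j_t=2\delta_{ij}\,dt$. Parallel transport along $X$ is $/\!/_t=U_tU_0^{-1}:T_xM\to T_{X_t(x)}M$. In the formulas, $B$ is regarded as the $T_xM$-valued process $U_0B$ (the martingale part of the antidevelopment of $X(x)$ to $T_xM$). $L^{1,2}([0,T];\mathbb{R})$ is the Cameron-Martin space of absolutely continuous paths with square-integrable derivative. $(\alpha_t)_{0\le t\le T}$ is a time-dependent 1-form on $M$ with $\alpha_0=\alpha$ satisfying $$\frac{d}{dt}\alpha_t=\left(\square+\nabla_Z-\operatorname{Ric}^{*}_{-Z}+\operatorname{div}Z\right)\alpha_t,$$ where $\square=\operatorname{trace}\nabla^2$ is the connection Laplacian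 on 1-forms and $\operatorname{Ric}^{*}_{-Z}$ acts on a 1-form $\phi$ by $\phi\mapsto\phi\circ(\operatorname{Ric}^\sharp+(\nabla_\bullet Z)^* )$. In the martingale, $\alpha_{T-t}$ is evaluated at $X_t(x)$. *)

(* Defs.v *)
From HB Require Import structures.
From mathcomp Require Import all_boot all_order all_algebra.
From mathcomp Require Import all_classical all_reals all_analysis.

Set Implicit Arguments.
Unset Strict Implicit.
Unset Printing Implicit Defensive.

Import Order.TTheory GRing.Theory Num.Theory.
Import numFieldNormedType.Exports.

Local Open Scope classical_set_scope.
Local Open Scope ring_scope.

Section smooth_functions.
Context (R : realType) (m n : nat).

Fixpoint Ck (k : nat) (A : set 'M[R]_(m, n)) (f : 'M[R]_(m, n) -> R) : Prop :=
  match k with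
  | 0 => forall y, A y -> {for y, continuous f}
  | k'.+1 => (forall y, A y -> differentiable f y) /\
             forall i j, Ck k' A (fun y => 'D_(delta_mx i j) f y)
  end.

(* A is meant to be open *)
Definition smooth_on (A : set 'M[R]_(m, n)) (f : 'M[R]_(m, n) -> R) : Prop :=
  forall k, Ck k A f.

End smooth_functions.

Section manifolds.
Context (R : realType) (n : nat).

Record chart (M : topologicalType) := Chart {
  cdom : set M;
  cmap :> M -> 'cV[R]_n;
  cinv : 'cV[R]_n -> M }.

Definition crange (M : topologicalType) (c : chart M) : set 'cV[R]_n :=
  c @` cdom c.

Definition is_chart (M : topologicalType) (c : chart M) : Prop :=
  [/\ open (cdom c), open (crange c),
      forall p, cdom c p -> cinv c (c p) = p,
      {within cdom c, continuous c} &
      {within crange c, continuous (cinv c)}].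

(* The smooth structure is given by a countable atlas, possibly with
   repetitions. For a Hausdorff space covered by charts, the existence of a
   countable atlas is the same as second countability. *)
Record manifold := Manifold {
  carrier :> topologicalType;
  atlas : nat -> chart carrier;
  manifold_hausdorff : hausdorff_space carrier;
  atlas_chart : forall k, is_chart (atlas k);
  atlas_cover : forall p, exists k, cdom (atlas k) p;
  atlas_smooth : forall j k i,
    smooth_on (atlas j @` (cdom (atlas j) `&` cdom (atlas k)))
      (fun y => atlas k (cinv (atlas j) y) i 0) }.

End manifolds.

Section geometry.
Context (R : realType) (n : nat) (M : manifold R n).
Implicit Types (c : chart R n M) (p : M).

(* The first chart of the atlas around p. Tangent vectors at p are represented
   by their components in this chart, so that T_pM is 'cV[R]_n, covectors at p
   are row vectors, endomorphisms of T_pM and linear maps R^n -> T_pM are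
   square matrices, and a bilinear form b on T_pM is the matrix with
   b(v, w) = v^T b w. *)
Definition chart_at p : chart R n M :=
  atlas M (xget 0%N [set k | cdom (atlas M k) p /\
                             forall j, (j < k)%N -> ~ cdom (atlas M j) p]).

Definition smooth_in c (F : M -> R) : Prop :=
  smooth_on (crange c) (F \o cinv c).

(* coordinate derivative of F in the chart c at p *)
Definition pd c (i : 'I_n) (F : M -> R) p : R :=
  'D_(delta_mx i 0) (F \o cinv c) (c p).

Definition jacobian c c' p : 'M[R]_n :=
  \matrix_(k, i) pd c i (fun q => c' q k 0) p.

(* components in the chart c of a vector field, a 1-form, a bilinear form *)
Definition vcomp c (V : M -> 'cV[R]_n) p : 'cV[R]_n :=
  jacobian (chart_at p) c p *m V p.

Definition fcomp c (phi : M -> 'rV[R]_n) p : 'rV[R]_n :=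
  phi p *m jacobian c (chart_at p) p.

Definition bcomp c (b : M -> 'M[R]_n) p : 'M[R]_n :=
  (jacobian c (chart_at p) p)^T *m b p *m jacobian c (chart_at p) p.

Definition smooth_vector_field (V : M -> 'cV[R]_n) : Prop :=
  forall k i, smooth_in (atlas M k) (fun p => vcomp (atlas M k) V p i 0).

Definition smooth_one_form (phi : M -> 'rV[R]_n) : Prop :=
  forall k i, smooth_in (atlas M k) (fun p => fcomp (atlas M k) phi p 0 i).

Record riemannian_metric := RiemannianMetric {
  metric :> M -> 'M[R]_n;
  metric_sym : forall p, (metric p)^T = metric p;
  metric_pos : forall p (v : 'cV[R]_n), v != 0 ->
    0 < (v^T *m metric p *m v) 0 0;
  metric_smooth : forall k i j,
    smooth_in (atlas M k) (fun p => bcomp (atlas M k) metric p i j) }.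

Context (g : riemannian_metric).

Definition inner p (v w : 'cV[R]_n) : R := (v^T *m g p *m w) 0 0.

Definition flat (V : M -> 'cV[R]_n) p : 'rV[R]_n := (V p)^T *m g p.

Definition sharp (phi : M -> 'rV[R]_n) p : 'cV[R]_n :=
  invmx (g p) *m (phi p)^T.

Definition adjoint p (A : 'M[R]_n) : 'M[R]_n := invmx (g p) *m A^T *m g p.

Definition bounded_vector_field (V : M -> 'cV[R]_n) : Prop :=
  exists C, forall p, Num.sqrt (inner p (V p) (V p)) <= C.

(* Christoffel symbol Gamma^k_{ij} of the Levi-Civita connection *)
Definition christoffel c (k i j : 'I_n) p : R :=
  2^-1 * \sum_l invmx (bcomp c g p) k l *
    (pd c i (fun q => bcomp c g q j l) p + pd c j (fun q => bcomp c g q i l) p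
     - pd c l (fun q => bcomp c g q i j) p).

(* the endomorphism v |-> nabla_v V, in the chart c *)
Definition nabla_in c (V : M -> 'cV[R]_n) p : 'M[R]_n :=
  \matrix_(k, i) (pd c i (fun q => vcomp c V q k 0) p
                  + \sum_j christoffel c k i j p * vcomp c V p j 0).

Definition nabla (V : M -> 'cV[R]_n) p : 'M[R]_n := nabla_in (chart_at p) V p.

Definition div (V : M -> 'cV[R]_n) p : R := \tr (nabla V p).

Definition div_form (phi : M -> 'rV[R]_n) p : R := div (sharp phi) p.

(* R^l_{kij}, where R(d_i, d_j) d_k = R^l_{kij} d_l and
   R(X, Y) = [nabla_X, nabla_Y] - nabla_[X, Y] *)
Definition riemann c (l k i j : 'I_n) p : R :=
  pd c i (christoffel c l j k) p - pd c j (christoffel c l i k) p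
  + \sum_m (christoffel c l i m p * christoffel c m j k p
            - christoffel c l j m p * christoffel c m i k p).

(* Ric(v, w) = trace (u |-> R(u, v) w) *)
Definition ricci p : 'M[R]_n :=
  \matrix_(j, k) \sum_i riemann (chart_at p) i k i j p.

Definition ricci_sharp p : 'M[R]_n := invmx (g p) *m ricci p.

(* (nabla_{d_j} phi)(d_k) *)
Definition nabla_form_in c (phi : M -> 'rV[R]_n) (j k : 'I_n) p : R :=
  pd c j (fun q => fcomp c phi q 0 k) p
  - \sum_m christoffel c m j k p * fcomp c phi p 0 m.

Definition nabla_form (Z : M -> 'cV[R]_n) (phi : M -> 'rV[R]_n) p : 'rV[R]_n :=
  \row_k \sum_j Z p j 0 * nabla_form_in (chart_at p) phi j k p.

(* (nabla^2_{d_i, d_j} phi)(d_k) *)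
Definition nabla2_form_in c (phi : M -> 'rV[R]_n) (i j k : 'I_n) p : R :=
  pd c i (nabla_form_in c phi j k) p
  - \sum_m christoffel c m i j p * nabla_form_in c phi m k p
  - \sum_m christoffel c m i k p * nabla_form_in c phi j m p.

Definition connection_laplacian (phi : M -> 'rV[R]_n) p : 'rV[R]_n :=
  \row_k \sum_i \sum_j
    invmx (g p) i j * nabla2_form_in (chart_at p) phi i j k p.

Definition is_geodesic (gam : R -> M) : Prop :=
  continuous gam /\
  forall k t, cdom (atlas M k) (gam t) ->
    let y (i : 'I_n) (s : R) := atlas M k (gam s) i 0 in
    (forall i, \forall s \near t, derivable (y i) s 1) /\
    forall i, derivable (derive1 (y i)) t 1 /\
      derive1 (derive1 (y i)) t
      + \sum_a \sum_b christoffel (atlas M k) i a b (gam t) *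
          derive1 (y a) t * derive1 (y b) t = 0.

Definition complete_metric : Prop :=
  forall p (v : 'cV[R]_n), exists gam, [/\ is_geodesic gam, gam 0 = p &
    forall i, derive1 (fun s => chart_at p (gam s) i 0) 0 = v i 0].

(* Functions on the bundle Hom(R^n, TM), whose points are pairs of a point p
   and a linear map R^n -> T_pM; the orthonormal frame bundle O(M) is a closed
   submanifold of it, so the smooth functions on O(M) are the restrictions of
   the smooth functions on Hom(R^n, TM). The chart c of M induces the chart
   (p, u) |-> row_mx (c p) (components of u in c). *)
Definition frame_local c (f : M -> 'M[R]_n -> R) (z : 'M[R]_(n, 1 + n)) : R :=
  let p := cinv c (lsubmx z) in f p (jacobian c (chart_at p) p *m rsubmx z).

Definition smooth_frame_function (f : M -> 'M[R]_n -> R) : Prop :=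
  forall k, smooth_on (lsubmx @^-1` crange (atlas M k))
              (frame_local (atlas M k) f).

Definition orthonormal_frame p (u : 'M[R]_n) : Prop := u^T *m g p *m u = 1%:M.

(* Derivative of f at (p, u) in the direction of the horizontal lift of
   v in T_pM; a horizontal curve satisfies
   d/dt u^m_j = - Gamma^m_{kl} (d/dt x^k) u^l_j. *)
Definition horizontal_derivative (f : M -> 'M[R]_n -> R) p (u : 'M[R]_n)
    (v : 'cV[R]_n) : R :=
  let c := chart_at p in
  'D_(row_mx v (\matrix_(m, j) - \sum_k \sum_l
                  christoffel c m k l p * v k 0 * u l j))
    (frame_local c f) (row_mx (c p) u).

(* the standard horizontal vector field H_i, and the horizontal lift of Z *)
Definition std_horizontal (i : 'I_n) (f : M -> 'M[R]_n -> R) p (u : 'M[R]_n) :=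
  horizontal_derivative f p u (col i u).

Definition horizontal_lift (Z : M -> 'cV[R]_n) (f : M -> 'M[R]_n -> R) p
    (u : 'M[R]_n) :=
  horizontal_derivative f p u (Z p).

End geometry.

Section real_paths.
Context (R : realType).

(* derivative at t of f, regarded as a function on [0, T] *)
Definition has_derivative_on (V : normedModType R) (T : R) (f : R -> V) (t : R)
    (l : V) : Prop :=
  (fun s => (s - t)^-1 *: (f s - f t)) @ within `[0, T] t^' --> l.

Definition abs_continuous (T : R) (x : R -> R) : Prop :=
  forall e, 0 < e -> exists2 d, 0 < d &
    forall (m : nat) (a b : nat -> R),
      (forall i, (i < m)%N -> 0 <= a i /\ a i <= b i /\ b i <= T) ->
      (forall i, (i.+1 < m)%N -> b i <= a i.+1) ->
      \sum_(i < m) (b i - a i) < d ->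
      \sum_(i < m) `|x (b i) - x (a i)| < e.

Definition cameron_martin (T : R) (x : R -> R) : Prop :=
  abs_continuous T x /\
  (\int[lebesgue_measure]_(t in `[0%R, T]) ((derive1 x t) ^+ 2)%:E < +oo)%E.

End real_paths.

Section stochastic_calculus.
Context (R : realType) (d : measure_display) (Omega : measurableType d)
  (P : probability Omega R).

Record filtration := Filtration {
  events :> R -> set (set Omega);
  events_sigma_algebra : forall t, 0 <= t -> sigma_algebra setT (events t);
  events_measurable : forall t A, 0 <= t -> events t A -> measurable A;
  events_mono : forall s t, 0 <= s -> s <= t -> events s `<=` events t }.

Context (F : filtration).

Definition measurable_at (t : R) (Y : Omega -> R) : Prop :=
  forall A : set R, measurable A -> F t (Y @^-1` A).

Definition martingale (T : R) (N : R -> Omega -> R) : Prop :=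
  (forall t, 0 <= t -> t <= T ->
     measurable_at t (N t) /\ P.-integrable setT (EFin \o N t)) /\
  forall s t A, 0 <= s -> s <= t -> t <= T -> F s A ->
    (\int[P]_(w in A) (N t w)%:E = \int[P]_(w in A) (N s w)%:E)%E.

(* n-dimensional F-Brownian motion with covariation 2 delta_ij dt *)
Definition brownian2 (n : nat) (B : R -> Omega -> 'cV[R]_n) : Prop :=
  [/\ forall t i, 0 <= t -> measurable_at t (fun w => B t w i 0),
      {ae P, forall w, B 0 w = 0},
      {ae P, forall w, {within `[0, +oo[, continuous (B ^~ w)}} &
      forall s t A (C : 'I_n -> set R), 0 <= s -> s < t -> F s A ->
        (forall i, measurable (C i)) ->
        (P (A `&` [set w | forall i, C i (B t w i 0%R - B s w i 0%R)%R]) =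
         P A * \big[*%E/1]_i normal_prob 0%R (Num.sqrt (2 * (t - s)))%R (C i))%E].

(* Q holds outside an event of probability at most e *)
Definition holds_up_to (e : R) (Q : Omega -> Prop) : Prop :=
  exists A, [/\ measurable A, (P A <= e%:E)%E & forall w, ~ A w -> Q w].

Record simple_process := SimpleProcess {
  sp_size : nat;
  sp_time : nat -> R;
  sp_val : nat -> Omega -> R;
  sp_time0 : 0 <= sp_time 0;
  sp_time_mono : forall i, sp_time i <= sp_time i.+1;
  sp_val_bounded : forall i, exists C, forall w, `|sp_val i w| <= C;
  sp_val_measurable : forall i, measurable_at (sp_time i) (sp_val i) }.

Definition simple_fun (S : simple_process) (s : R) (w : Omega) : R :=
  \sum_(i < sp_size S)
    sp_val S i w * ((sp_time S i < s) && (s <= sp_time S i.+1))%:R.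

Definition simple_integral (S : simple_process) (W : R -> Omega -> R) (t : R)
    (w : Omega) : R :=
  \sum_(i < sp_size S) sp_val S i w *
    (W (Num.min (sp_time S i.+1) t) w - W (Num.min (sp_time S i) t) w).

(* I is a version of the Ito integral of H against W on [0, T], for a
   continuous martingale W with bounded d<W>/dt: the limit, uniformly on [0, T]
   in probability, of the integrals of simple processes which approximate H in
   L^2([0, T]) in probability. *)
Definition ito_integral (T : R) (H W I : R -> Omega -> R) : Prop :=
  [/\ forall t, 0 <= t -> t <= T -> measurable_fun setT (I t),
      {ae P, forall w, {within `[0, T], continuous (I ^~ w)}},
      {ae P, forall w, measurable_fun `[0, T] (H ^~ w)} &
      exists S : nat -> simple_process, forall e, 0 < e ->
        exists K, forall k, (K <= k)%N -> holds_up_to e (fun w =>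
          (\int[lebesgue_measure]_(s in `[0%R, T])
             ((simple_fun (S k) s w - H s w) ^+ 2)%:E <= e%:E)%E /\
          forall t, 0 <= t -> t <= T ->
            `|simple_integral (S k) W t w - I t w| <= e)].

(* I is a version of the vector process whose i-th coordinate is
   sum_j int K_ij dW^j *)
Definition vector_ito_integral (n : nat) (T : R) (K : R -> Omega -> 'M[R]_n)
    (W I : R -> Omega -> 'cV[R]_n) : Prop :=
  exists J : 'I_n -> 'I_n -> R -> Omega -> R,
    (forall i j, ito_integral T (fun s w => K s w i j) (fun s w => W s w j 0)
                   (J i j)) /\
    forall t w i, 0 <= t -> t <= T -> I t w i 0 = \sum_j J i j t w.

(* C is a version of the covariation [Y, W], of finite variation *)
Definition covariation (Y W C : R -> Omega -> R) : Prop :=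
  [/\ forall t, 0 <= t -> measurable_fun setT (C t),
      {ae P, forall w, {within `[0, +oo[, continuous (C ^~ w)}},
      {ae P, forall w, forall t, 0 <= t -> bounded_variation 0 t (C ^~ w)} &
      forall t e, 0 <= t -> 0 < e -> exists2 delta, 0 < delta &
        forall (m : nat) (tau : nat -> R), tau 0%N = 0 -> tau m = t ->
          (forall i, (i < m)%N ->
             tau i <= tau i.+1 /\ tau i.+1 - tau i < delta) ->
          holds_up_to e (fun w =>
            `|\sum_(i < m) (Y (tau i.+1) w - Y (tau i) w) *
                           (W (tau i.+1) w - W (tau i) w) - C t w| <= e)].

(* int Y o dW = int Y dW + [Y, W] / 2 *)
Definition stratonovich_integral (Y W I : R -> Omega -> R) : Prop :=
  exists J C : R -> Omega -> R,
    [/\ forall T, 0 <= T -> ito_integral T Y W J, covariation Y W C &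
        forall t w, 0 <= t -> I t w = J t w + 2^-1 * C t w].

Context (n : nat) (M : manifold R n) (g : riemannian_metric M).

(* The process with values (X_t, U_t), U_t : R^n -> T_{X_t}M, is a continuous
   adapted non-explosive process in O(M) with X_0 = x, which solves
   dU = sum_i H_i(U) o dB^i + Zbar(U) dt. As usual for equations on a
   manifold, this means that f(X, U) has the corresponding differential for
   every smooth test function f. Continuity of (X, U) is continuity of X and
   of the components of U in every chart. *)
Definition horizontal_diffusion (Z : M -> 'cV[R]_n) (x : M)
    (B : R -> Omega -> 'cV[R]_n) (X : R -> Omega -> M)
    (U : R -> Omega -> 'M[R]_n) : Prop :=
  [/\ forall w, X 0 w = x,
      forall t w, 0 <= t -> orthonormal_frame g (X t w) (U t w),
      forall t, 0 <= t ->
        (forall O : set M, open O -> F t (X t @^-1` O)) /\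
        (forall i j, measurable_at t (fun w => U t w i j)),
      forall w, {within `[0, +oo[, continuous (X ^~ w)} /\
        forall k, {within [set t | 0 <= t /\ cdom (atlas M k) (X t w)],
          continuous (fun t =>
            jacobian (chart_at (X t w)) (atlas M k) (X t w) *m U t w)} &
      forall f, smooth_frame_function f ->
        exists I : 'I_n -> R -> Omega -> R,
          (forall i, stratonovich_integral
                       (fun t w => std_horizontal g i f (X t w) (U t w))
                       (fun t w => B t w i 0) (I i)) /\
          {ae P, forall w, forall t, 0 <= t ->
             f (X t w) (U t w) = f (X 0 w) (U 0 w) + \sum_i I i t w
               + \int[lebesgue_measure]_(s in `[0, t])
                   horizontal_lift g Z f (X s w) (U s w)}].

Definition parallel_transport (U : R -> Omega -> 'M[R]_n) (t : R) (w : Omega) :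
    'M[R]_n :=
  U t w *m invmx (U 0 w).

End stochastic_calculus.

(* Main.v *)
Require Import Defs.
From mathcomp Require Import all_boot all_order all_algebra.
From mathcomp Require Import all_classical all_reals all_analysis.
From mathcomp Require Import measurable_realfun.

(** Write N_t for the process assumed to be a martingale. The formula is the
    equality of the expectations of N at the two ends of [0, T].

    At time 0, h vanishes and so does the stochastic integral, almost surely
    ([ito_integral0]), hence E[N_0] = 0. At time T, h equals 1 and alpha_0 is
    V^flat, so that N_T = D - Y / 2, where D = (div V)(X_T) because sharp
    inverts flat ([flatK]), and Y is the inner product of V(X_T) with
    parallel transport and Theta_T applied to the stochastic integral. Thus
    E[D - Y / 2] = 0.

    What remains is to pass from E[D - Y / 2] = 0 to E[D] = E[Y] / 2. Only the
    difference N_T is known to be integrable, so linearity of the integral does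
    not apply. It is enough, however, that D and Y are measurable: since D and
    Y / 2 differ by an integrable function, the positive parts of both have
    infinite integrals, or of neither, and the same holds for the negative
    parts. With the convention +oo - +oo = -oo the two expectations then agree
    in the infinite cases too ([integral_eq_of_diff]).

    Measurability of Y follows from that of D, and D is measurable because
    div V is a Borel function on M ([measurable_div]). *)

Set Implicit Arguments.
Unset Strict Implicit.
Unset Printing Implicit Defensive.

Import Order.TTheory GRing.Theory Num.Theory.
Import numFieldNormedType.Exports.

Local Open Scope classical_set_scope.
Local Open Scope ring_scope.

(** * Measurability of the inverse matrix *)

Section measurable_matrices.
Context (R : realType) (d : measure_display) (T : measurableType d).

Lemma measurable_inv : measurable_fun setT (fun x : R => x^-1).
Proof.
have -> : [set: R] = [set 0] `|` ~` [set 0] by rewrite setUv.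
apply/measurable_funU => //; first exact: measurableC.
split; first exact: measurable_fun_set1.
apply: open_continuous_measurable_fun.
  rewrite openC.
  exact: accessible_closed_set1 (hausdorff_accessible (@Rhausdorff R)) _.
by move=> x; rewrite inE => /eqP x0; exact: inv_continuous.
Qed.

Lemma measurable_det (D : set T) n (A : T -> 'M[R]_n) :
  (forall i j, measurable_fun D (fun w => A w i j)) ->
  measurable_fun D (fun w => \det (A w)).
Proof.
move=> mA; apply: measurable_sum => s; apply: measurable_funM => //.
by apply: measurable_prod => i _; exact: mA.
Qed.

(** Cramer's rule where the determinant is nonzero; elsewhere [invmx] is the
    identity map, so that the inverse is a Borel function on all matrices. *)
Lemma measurable_invmx (D : set T) n (A : T -> 'M[R]_n) : measurable D ->
  (forall i j, measurable_fun D (fun w => A w i j)) ->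
  forall i j, measurable_fun D (fun w => invmx (A w) i j).
Proof.
move=> mD mA i j.
have mdet := measurable_det mA.
pose a w := \det (A w) == 0.
have ma : measurable_fun D a.
  exact: measurable_fun_eqr.
have -> : (fun w => invmx (A w) i j) = fun w =>
    if a w then A w i j else (\det (A w))^-1 * cofactor (A w) j i.
  apply/funext => w; rewrite /invmx unitmxE unitfE /a.
  by case: eqP => //= _; rewrite !mxE.
apply: measurable_fun_if => //.
  by apply: measurable_funS (mA i j) => // w [].
apply: (@measurable_funS _ _ _ _ D) => //.
apply: measurable_funM.
  by apply: measurableT_comp mdet; exact: measurable_inv.
apply: measurable_funM => //; apply: measurable_det => k l.
by under eq_fun do rewrite !mxE; exact: mA.
Qed.

End measurable_matrices.

(** * Measurability of the divergence along a random point *)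

Section smooth_along.
Context (R : realType) (d : measure_display) (T : measurableType d).
Context (n : nat) (M : manifold R n) (Y : T -> M).
Context (mY : forall O : set M, open O -> measurable (Y @^-1` O)).

Lemma measurable_chart_comp (c : chart R n M) (G : 'cV[R]_n -> R) :
  is_chart c -> (forall y, crange c y -> {for y, continuous G}) ->
  measurable_fun (Y @^-1` cdom c) (fun w => G (c (Y w))).
Proof.
case=> oc _ _ cc _ cG.
have cGc : {in cdom c, continuous (fun p => G (c p))}.
  move=> p /[dup] cp; rewrite inE => dp.
  apply: continuous_comp; last by apply: cG; exists p.
  by move: cc; rewrite continuous_open_subspace //; apply.
apply: (measurability _ (RGenOpens.measurableE R)).
move=> _ [_ [a [b ->]] <-].
rewrite (_ : _ `&` _ =
  Y @^-1` (cdom c `&` (fun p => G (c p)) @^-1` `]a, b[%classic)) //.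
apply: mY; apply: ((continuous_inP _ oc).1 cGc). exact: interval_open.
Qed.

Lemma measurable_smooth (c : chart R n M) (F : M -> R) :
  is_chart c -> smooth_in c F ->
  measurable_fun (Y @^-1` cdom c) (fun w => F (Y w)).
Proof.
move=> hc sF.
have := measurable_chart_comp hc (sF 0%N); apply: eq_measurable_fun => w.
by rewrite inE /= => dw; case: hc => _ _ ->.
Qed.

Lemma measurable_pd (c : chart R n M) (F : M -> R) (i : 'I_n) :
  is_chart c -> smooth_in c F ->
  measurable_fun (Y @^-1` cdom c) (fun w => pd c i F (Y w)).
Proof.
move=> hc sF; have [_ /(_ i 0) cdF] := sF 1%N.
exact: measurable_chart_comp hc cdF.
Qed.

(** The components of the metric and their derivatives are continuous in the
    chart, and [measurable_invmx] covers the inverse metric. *)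
Lemma measurable_christoffel (g : riemannian_metric M) m k i j :
  measurable_fun (Y @^-1` cdom (atlas M m))
    (fun w => christoffel g (atlas M m) k i j (Y w)).
Proof.
have hc := atlas_chart M m; have sg := metric_smooth g m.
have mD : measurable (Y @^-1` cdom (atlas M m)) by apply: mY; case: hc.
apply: measurable_funM => //; apply: measurable_sum => l.
apply: measurable_funM.
  apply: (measurable_invmx mD) => a b.
  exact: measurable_smooth hc (sg a b).
by apply: measurable_funB; [apply: measurable_funD|];
  apply: measurable_pd => //; exact: sg.
Qed.

Lemma measurable_div_in (g : riemannian_metric M) (V : M -> 'cV[R]_n) m :
  smooth_vector_field V ->
  measurable_fun (Y @^-1` cdom (atlas M m))
    (fun w => \tr (nabla_in g (atlas M m) V (Y w))).
Proof.
move=> sV; have hc := atlas_chart M m.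
apply: measurable_sum => k; under eq_fun do rewrite mxE.
apply: measurable_funD.
  exact: measurable_pd hc (sV m k).
apply: measurable_sum => j; apply: measurable_funM.
  exact: measurable_christoffel.
exact: measurable_smooth hc (sV m j).
Qed.

(** The divergence at p is computed in the first chart of the atlas around p.
    This chart depends on p, but it is constant on each piece of a countable
    Borel partition of M, and on each piece the formula in a fixed chart
    applies. *)
Lemma measurable_div (g : riemannian_metric M) (V : M -> 'cV[R]_n) :
  smooth_vector_field V -> measurable_fun setT (fun w => div g V (Y w)).
Proof.
move=> sV.
pose first m p := cdom (atlas M m) p /\
                  forall j, (j < m)%N -> ~ cdom (atlas M j) p.
have first_unique p m m' : first m p -> first m' p -> m = m'.
  move=> [dm fm] [dm' fm']; case: (ltngtP m m') => // lt.
    by case: (fm' _ lt).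
  by case: (fm _ lt).
have chart_first p m : first m p -> chart_at p = atlas M m.
  move=> fm; rewrite /chart_at; congr atlas; apply: (@first_unique p) => //.
  exact: (@xgetPex _ 0%N [set k | first k p] (ex_intro _ m fm)).
have mcdom m : measurable (Y @^-1` cdom (atlas M m)).
  by apply: mY; case: (atlas_chart M m).
pose E m := [set w | first m (Y w)].
have -> : [set: T] = \bigcup_m E m.
  apply/esym/seteqP; split => // w _.
  have [k dk] := atlas_cover (Y w).
  have ex : exists k, `[< cdom (atlas M k) (Y w) >] by exists k; apply/asboolP.
  exists (ex_minn ex) => //; case: ex_minnP => m /asboolP dm minm; split => //.
  by move=> j jm /asboolP /minm; rewrite leqNgt jm.
have mE m : measurable (E m).
  rewrite (_ : E m = Y @^-1` cdom (atlas M m) `&`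
      ~` \bigcup_(j < m) (Y @^-1` cdom (atlas M j))).
    apply: measurableI => //; apply: measurableC.
    by apply: bigcup_measurable => j _; exact: mcdom.
  apply/seteqP; split => w.
    by case=> dm fm; split => // -[j jm]; exact: fm.
  by case=> dm fm; split => // j jm dj; apply: fm; exists j.
apply/measurable_fun_bigcup => // m.
apply: (@eq_measurable_fun _ _ _ _ _
  (fun w => \tr (nabla_in g (atlas M m) V (Y w)))).
  by move=> w; rewrite inE => /chart_first; rewrite /div /nabla => ->.
apply: measurable_funS (mcdom m) _ (@measurable_div_in g V m sV).
by move=> w [].
Qed.

End smooth_along.

(** * Expectations of functions with an integrable difference *)

Section integral_of_difference.
Context (R : realType) (d : measure_display) (T : measurableType d)
  (mu : {measure set T -> \bar R}).
Local Open Scope ereal_scope.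

Lemma integral_pinfty_transfer (f g k : T -> \bar R) :
  measurable_fun setT f -> measurable_fun setT g -> mu.-integrable setT k ->
  (forall w, 0 <= f w) -> (forall w, 0 <= g w) ->
  (forall w, f w <= g w + `|k w|) ->
  \int[mu]_w f w = +oo -> \int[mu]_w g w = +oo.
Proof.
move=> mf mg /integrableP[mk ik] f0 g0 fgk fy.
apply/eqP; case: eqVneq => //; rewrite -ltey => ig.
suff : \int[mu]_w f w < +oo by rewrite fy ltxx.
have mak : measurable_fun setT (fun w => `|k w|) by exact: measurableT_comp.
apply: (@le_lt_trans _ _ (\int[mu]_w (g w + `|k w|))).
  apply: ge0_le_integral => //.
  exact: emeasurable_funD.
rewrite ge0_integralD //; exact: lte_add_pinfty.
Qed.

(** Linearity gives this when f and g are integrable. Otherwise f^+ and g^+, and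
    likewise f^- and g^-, differ by at most the integrable function |f - g|, so
    that their integrals are infinite together. If the integrals of the
    negative parts are infinite, both sides are -oo, whatever happens to the
    positive parts; if only those of the positive parts are, both are +oo. *)
Lemma integral_eq_of_diff (f g : T -> R) :
  measurable_fun setT f -> measurable_fun setT g ->
  mu.-integrable setT (fun w => (f w - g w)%:E) ->
  \int[mu]_w (f w - g w)%:E = 0 ->
  \int[mu]_w (f w)%:E = \int[mu]_w (g w)%:E.
Proof.
move=> mf mg ik ik0.
have mF : measurable_fun setT (EFin \o f) by exact/measurable_EFinP.
have mG : measurable_fun setT (EFin \o g) by exact/measurable_EFinP.
pose p (u : T -> R) := \int[mu]_w (EFin \o u)^\+ w.
pose q (u : T -> R) := \int[mu]_w (EFin \o u)^\- w.
have E u : \int[mu]_w (u w)%:E = p u - q u by rewrite integralE.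
have pq0 u : 0 <= p u /\ 0 <= q u by split; apply: integral_ge0.
have key : forall u v : T -> R,
  measurable_fun setT (EFin \o u) -> measurable_fun setT (EFin \o v) ->
  mu.-integrable setT (fun w => (u w - v w)%:E) ->
  (p u = +oo -> p v = +oo) /\ (q u = +oo -> q v = +oo).
  move=> u v mEu mEv iuv; split.
  - apply: (integral_pinfty_transfer (k := fun w => (u w - v w)%:E)) => //.
    + exact: measurable_funepos.
    + exact: measurable_funepos.
    + move=> w; rewrite !funeposE /= -!EFin_max -EFinD lee_fin.
      rewrite ge_max; apply/andP; split.
        rewrite -[leLHS](subrK (v w)) addrC lerD // ?ler_norm //.
        by rewrite le_max lexx.
      by rewrite addr_ge0 // le_max lexx orbT.
  - apply: (integral_pinfty_transfer (k := fun w => (u w - v w)%:E)) => //.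
    + exact: measurable_funeneg.
    + exact: measurable_funeneg.
    + move=> w; rewrite !funenegE /= -!EFin_max -EFinD lee_fin.
      rewrite ge_max; apply/andP; split.
        rewrite (_ : - u w = - v w + - (u w - v w))%R; last first.
          by rewrite opprB addKr.
        apply: lerD; first by rewrite le_max lexx.
        by rewrite -normrN ler_norm.
      by rewrite addr_ge0 // le_max lexx orbT.
have igf : mu.-integrable setT (fun w => (g w - f w)%:E).
  rewrite (_ : (fun w => _) = fun w => - (f w - g w)%:E).
    exact: integrableN.
  by apply/funext => w; rewrite -EFinN opprB.
have [kp kq] := key f g mF mG ik; have [kp' kq'] := key g f mG mF igf.
have [qf|qf] := eqVneq (q f) +oo.
  by rewrite !E (kq qf) qf !addeNy.
have qg : q g != +oo by apply: contra_neq qf; exact: kq'.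
have [pf|pf] := eqVneq (p f) +oo.
  rewrite !E (kp pf) pf !addye //.
  + by rewrite eqe_oppLR.
  + by rewrite eqe_oppLR.
have pg : p g != +oo by apply: contra_neq pf; exact: kp'.
have int u : measurable_fun setT (EFin \o u) -> p u != +oo -> q u != +oo ->
    mu.-integrable setT (EFin \o u).
  move=> mEu pu qu; apply/integrableP; split => //.
  rewrite [ltLHS](_ : _ = p u + q u).
    by rewrite lte_add_pinfty // ltey.
  rewrite /p /q -ge0_integralD //; last 2 first.
  - exact: measurable_funepos.
  - exact: measurable_funeneg.
  by apply: eq_integral => w _; rewrite -/((abse \o (EFin \o u)) w) fune_abse.
have fF := int _ mF pf qf; have fG := int _ mG pg qg.
have := ik0; under eq_integral do rewrite EFinB.
rewrite (integralB measurableT fF fG) => /eqP.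
rewrite sube_eq ?add0e => [/eqP//| |].
  exact: integrable_fin_num fF.
by rewrite fin_num_adde_defr.
Qed.

(** Multiplication by a positive real distributes over the difference of the
    integrals of f^+ and f^- even when it is +oo - +oo = -oo. *)
Lemma integralZl_pos (f : T -> R) (c : R) : (0 < c)%R ->
  measurable_fun setT f ->
  \int[mu]_w (c * f w)%:E = c%:E * \int[mu]_w (f w)%:E.
Proof.
move=> c0 mf.
have mF : measurable_fun setT (EFin \o f) by exact/measurable_EFinP.
have mp := measurable_funepos mF; have mn := measurable_funeneg mF.
rewrite integralE [in RHS]integralE.
rewrite (_ : (fun w => (c * f w)%:E) = (fun w => c%:E * (EFin \o f) w)) //.
rewrite ge0_funeposM ?ltW // ge0_funenegM ?ltW //.
rewrite !ge0_integralZl ?lee_fin ?ltW //.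
set p := \int[_]_(_ in _) _; set q := \int[_]_(_ in _) _.
have q0 : 0 <= q by exact: integral_ge0.
clearbody p q.
have [->|qf] := eqVneq q +oo.
  by rewrite gt0_muley ?lte_fin // !addeNy gt0_muleNy ?lte_fin.
by rewrite muleBr // fin_num_adde_defl // fin_numN ge0_fin_numE // ltey.
Qed.

End integral_of_difference.

(** * Musical isomorphisms *)

Section musical_isomorphisms.
Context (R : realType) (n : nat) (M : manifold R n) (g : riemannian_metric M).

Lemma metric_unit p : g p \in unitmx.
Proof.
rewrite unitmxE unitfE; apply/negP => /det0P[v v0 vg].
have := Defs.metric_pos g p (v := v^T).
by rewrite trmxK vg mul0mx mxE ltxx trmx_eq0 => /(_ v0).
Qed.

Lemma flatK (V : M -> 'cV[R]_n) : sharp g (flat g V) = V.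
Proof.
apply/funext => p; rewrite /sharp /flat trmx_mul trmxK Defs.metric_sym.
by rewrite mulKmx ?metric_unit.
Qed.

End musical_isomorphisms.

(** * The stochastic integral at time 0 *)

Section ito_integral_at_0.
Context (R : realType) (d : measure_display) (Omega : measurableType d)
  (P : probability Omega R) (F : filtration R Omega).

(** All partition times are nonnegative, so stopping them at 0 gives 0. *)
Lemma simple_integral0 (S : simple_process F) (W : R -> Omega -> R) w :
  simple_integral S W 0 w = 0.
Proof.
have t0 i : 0 <= sp_time S i.
  elim: i => [|i IH]; first exact: sp_time0.
  exact: le_trans IH (sp_time_mono S i).
by apply: big1 => i _; rewrite !min_r // subrr mulr0.
Qed.

Lemma holds_up_to_ae (Q : Omega -> Prop) : measurable [set w | Q w] ->
  (forall e, 0 < e -> holds_up_to P e Q) -> {ae P, forall w, Q w}.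
Proof.
move=> mQ hQ; exists (~` [set w | Q w]); split => //; first exact: measurableC.
apply/eqP; rewrite eq_le measure_ge0 andbT; apply/lee_addgt0Pr => e e0.
have [A [mA PA AQ]] := hQ e e0; rewrite add0e; apply: le_trans PA.
apply: le_measure; rewrite ?inE //; first exact: measurableC.
by move=> w nQ; apply: contrapT => /AQ.
Qed.

(** The integrals of the approximating simple processes vanish at time 0 and
    converge to the stochastic integral in probability. *)
Lemma ito_integral0 (T : R) (H W J : R -> Omega -> R) : 0 <= T ->
  ito_integral P F T H W J -> {ae P, forall w, J 0 w = 0}.
Proof.
move=> T0 [mJ _ _ [S hS]].
have mJ0 := mJ 0 (lexx 0) T0.
have small (m : nat) : {ae P, forall w, `|J 0 w| <= m.+1%:R^-1}.
  apply: holds_up_to_ae.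
    rewrite (_ : [set w | _] =
      setT `&` J 0 @^-1` `[- m.+1%:R^-1, m.+1%:R^-1]%classic).
      by apply: mJ0 => //; exact: measurable_itv.
    by rewrite setTI; apply/seteqP; split => w /=; rewrite in_itv /= ler_norml.
  (* one error e' serves as the bound both for the probability and for J *)
  move=> e e0; pose e' := Num.min e m.+1%:R^-1.
  have e'0 : 0 < e' by rewrite lt_min e0 invr_gt0 ltr0n.
  have [K /(_ K (leqnn K)) [A [mA PA AK]]] := hS e' e'0.
  exists A; split => //.
    by apply: le_trans PA _; rewrite lee_fin ge_min lexx.
  move=> w /AK [_ /(_ 0 (lexx 0) T0)].
  rewrite simple_integral0 sub0r normrN => /le_trans; apply.
  by rewrite ge_min lexx orbT.
apply: filterS (ae_foralln small) => w Jw.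
apply/eqP; rewrite -normr_eq0 eq_le normr_ge0 andbT; apply/ler_addgt0Pr => e e0.
rewrite add0r; apply: le_trans (Jw (Num.truncn e^-1)) _.
rewrite invf_ple ?posrE ?ltr0n //.
by apply/ltW; rewrite truncnS_gt.
Qed.

End ito_integral_at_0.

Theorem theorem1p16 (R : realType) (n : nat) (M : manifold R n)
    (g : riemannian_metric M) (Z : M -> 'cV[R]_n)
    (d : measure_display) (Omega : measurableType d)
    (P : probability Omega R) (F : filtration R Omega)
    (B : R -> Omega -> 'cV[R]_n) (x : M) (X : R -> Omega -> M)
    (U : R -> Omega -> 'M[R]_n) (T : R) (h : R -> Omega -> R)
    (V : M -> 'cV[R]_n) (alpha : R -> M -> 'rV[R]_n)
    (Theta : R -> Omega -> 'M[R]_n) (I : R -> Omega -> 'cV[R]_n) :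
  complete_metric g ->
  connected [set: M] ->
  smooth_vector_field Z ->
  brownian2 P F B ->
  horizontal_diffusion P F g Z x B X U ->
  0 < T ->
  (forall t, 0 <= t -> t <= T -> measurable_at F t (h t)) ->
  (forall w, cameron_martin T (h ^~ w)) ->
  (forall w, h 0 w = 0) ->
  (forall w, h T w = 1) ->
  smooth_vector_field V ->
  bounded_vector_field g V ->
  alpha 0 = flat g V ->
  (forall t, 0 <= t -> t <= T -> smooth_one_form (alpha t)) ->
  (forall t p, 0 <= t -> t <= T ->
     has_derivative_on T (alpha ^~ p) t
       (connection_laplacian g (alpha t) p + nabla_form g Z (alpha t) p
        - alpha t p *m (ricci_sharp g p + adjoint g p (nabla g Z p))
        + div g Z p *: alpha t p)) ->
  (forall w, Theta 0 w = 1%:M) ->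
  (forall t w, 0 <= t -> t <= T -> Theta t w \in unitmx) ->
  (forall t w, 0 <= t -> t <= T ->
     has_derivative_on T (Theta ^~ w) t
       (- (invmx (parallel_transport U t w) *m
           (ricci_sharp g (X t w) + adjoint g (X t w) (nabla g Z (X t w))
            - (div g Z (X t w))%:M) *m
           parallel_transport U t w *m Theta t w))) ->
  vector_ito_integral P F T
    (fun t w => (derive1 (h ^~ w) t - div g Z (X t w) * h t w) *:
                invmx (Theta t w))
    (fun t w => U 0 w *m B t w) I ->
  martingale P F T (fun t w =>
    div_form g (alpha (T - t)) (X t w) * h t w
    - 2^-1 * (alpha (T - t) (X t w) *m
              (parallel_transport U t w *m Theta t w *m I t w)) 0 0) ->
  'E_P[fun w => div g V (X T w)]%E =
  (2^-1%:E *
   'E_P[fun w => inner g (X T w) (V (X T w))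
          (parallel_transport U T w *m Theta T w *m I T w)])%E.
Proof.
move=> _ _ _ _ [_ _ mX _ _] T0 _ _ h0 hT sV _ alpha0 _ _ _ _ _ [J [itoJ IJ]].
set N := (fun t w => _) => -[intN martN].
have T0' := ltW T0.
have [_ iN0] := intN 0 (lexx 0) T0'; have [mNT iNT] := intN T T0' (lexx T).
pose D w := div g V (X T w).
pose Y w := inner g (X T w) (V (X T w))
              (parallel_transport U T w *m Theta T w *m I T w).
have NT w : N T w = D w - 2^-1 * Y w.
  by rewrite /N subrr alpha0 hT mulr1 /div_form flatK.
have EN0 : (\int[P]_w (N 0 w)%:E = 0)%E.
  rewrite -[RHS](@integral0 _ _ _ P setT); apply: ae_eq_integral => //.
    by case/integrableP: iN0.
  have J0 : {ae P, forall w, forall i j, J i j 0 w = 0}.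
    apply: filter_forall => i; apply: filter_forall => j.
    exact: ito_integral0 T0' (itoJ i j).
  apply: filterS J0 => w J0 _; congr EFin; rewrite /N h0 mulr0 sub0r.
  suff -> : I 0 w = 0 by rewrite !mulmx0 mxE mulr0 oppr0.
  apply/colP => i; rewrite IJ // mxE; apply: big1 => j _; exact: J0.
have ENT : (\int[P]_w (N T w)%:E = 0)%E.
  rewrite -EN0; apply: martN => //.
  have [F0 FC _] := events_sigma_algebra F (lexx 0).
  by rewrite -(setD0 setT); exact: FC.
have mNT' : measurable_fun setT (N T).
  by apply/measurable_EFinP; case/integrableP: iNT.
have mD : measurable_fun setT D.
  apply: measurable_div => // O oO.
  by apply: (events_measurable (f := F) T0'); exact: (mX T T0').1.
have mY : measurable_fun setT Y.
  rewrite (_ : Y = fun w => 2 * (D w - N T w)).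
    by apply: measurable_funM => //; exact: measurable_funB.
  by apply/funext => w; rewrite NT opprB addrC subrK mulrA divff ?mul1r.
rewrite unlock -integralZl_pos ?invr_gt0 //.
apply: integral_eq_of_diff => //.
- exact: measurable_funM.
- by move: iNT; congr (_.-integrable _ _); apply/funext => w /=; rewrite NT.
- by rewrite -ENT; apply: eq_integral => w _; rewrite NT.
Qed.
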